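(* The class of Eulerian digraphs is not well-quasi-ordered under the strong immersion relation; that is, there is an infinite sequence $G_1,G_2,\dots$ of Eulerian digraphs such that for no $i<j$ does $G_i$ strongly immerse into $G_j$.
   Context: All digraphs are finite and may contain loops and parallel edges. A digraph is Eulerian if every vertex has in-degree equal to its out-degree. A path in a digraph is a sequence $(e_1,\dots,e_m)$ of pairwise distinct edges with $\mathrm{head}(e_i)=\mathrm{tail}(e_{i+1})$ for $1\le i<m$ (vertices may repeat); it goes from $\mathrm{tail}(e_1)$ to $\mathrm{head}(e_m)$ and its internal vertices are $\mathrm{head}(e_1),\dots,\mathrm{head}(e_{m-1})$. An immersion of a digraph $H$ into a digraph $G$ is a map $\gamma$ that sends the vertices of $H$ injectively to vertices of $G$ and each edge $(u,v)$ of $H$ to a path of $G$ from $\gamma(u)$ to $\gamma(v)$, such that the paths assigned to distinct edges are edge-disjoint. The immersion is strong if no vertex of $\gamma(V(H))$ is an internal vertex of any path $\gamma(e)$, $e\in E(H)$. We write $H\hookrightarrow G$ if $H$ strongly immerses into $G$. *)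

(* Defs.v *)
From mathcomp Require Import all_boot.
Set Implicit Arguments.
Unset Strict Implicit.
Unset Printing Implicit Defensive.

(* Edges form a type of their own, so loops and parallel edges are allowed. *)
Record digraph : Type := Digraph {
  vertex : finType;
  edge : finType;
  tail_of : edge -> vertex;
  head_of : edge -> vertex
}.

Definition indegree (D : digraph) (v : vertex D) : nat :=
  #|[set e : edge D | head_of e == v]|.

Definition outdegree (D : digraph) (v : vertex D) : nat :=
  #|[set e : edge D | tail_of e == v]|.

Definition eulerian (D : digraph) : Prop :=
  forall v : vertex D, indegree v = outdegree v.

(* Vertices may repeat, edges may not.  A path has at least one edge, so a loop
   of H is sent by an immersion to a nonempty closed path of G. *)
Definition is_path (D : digraph) (u v : vertex D) (p : seq (edge D)) : bool :=
  if p is e :: s then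
    [&& uniq (e :: s),
        path (fun a b : edge D => head_of a == tail_of b) e s,
        tail_of e == u
      & head_of (last e s) == v]
  else false.

(* [belast e s] is e :: s without its last edge. *)
Definition internal_vertices (D : digraph) (p : seq (edge D)) :
    seq (vertex D) :=
  if p is e :: s then [seq head_of a | a <- belast e s] else [::].

Record is_immersion (H G : digraph) (gV : vertex H -> vertex G)
    (gE : edge H -> seq (edge G)) : Prop := IsImmersion {
  immersion_inj : injective gV;
  immersion_path : forall e : edge H,
    is_path (gV (tail_of e)) (gV (head_of e)) (gE e);
  immersion_disjoint : forall (e f : edge H) (x : edge G),
    e != f -> x \in gE e -> x \notin gE f
}.

Definition is_strong (H G : digraph) (gV : vertex H -> vertex G)
    (gE : edge H -> seq (edge G)) : Prop :=
  forall (w : vertex H) (e : edge H), gV w \notin internal_vertices (gE e).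

Definition strongly_immerses (H G : digraph) : Prop :=
  exists (gV : vertex H -> vertex G) (gE : edge H -> seq (edge G)),
    is_immersion gV gE /\ is_strong gV gE.

(* Reflexivity and transitivity of R are deliberately not part of this
   definition, so that its negation always provides a bad sequence. *)
Definition well_quasi_ordered (T : Type) (C : T -> Prop)
    (R : T -> T -> Prop) : Prop :=
  forall f : nat -> T, (forall i, C (f i)) ->
    exists i j : nat, i < j /\ R (f i) (f j).

(* Main.v *)
Require Import Defs.
From mathcomp Require Import all_boot.

(** Orient a cycle of length 2n alternately, so that its vertices are n sources
    and n sinks, and add a hub h with two edges from h to each source and two
    from each sink to h.  The result is Eulerian: its edges split into
    triangles, one through each edge of the cycle.  When n >= 2 the hub is the
    only vertex of out-degree greater than 2, so a strong immersion sends hub to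
    hub and no path has the hub as an internal vertex.  Without the hub, every
    walk has at most one edge, so the immersion restricts to an embedding of one
    alternating cycle into another, and this forces equal lengths. *)

Set Implicit Arguments.
Unset Strict Implicit.
Unset Printing Implicit Defensive.

(** By finiteness [succ] is a bijection, so it carries the edges entering [v] onto those leaving
    [v]. *)
Lemma eulerian_of_succ (D : digraph) (succ : edge D -> edge D) :
    injective succ -> (forall e, tail_of (succ e) = head_of e) -> eulerian D.
Proof.
move=> succ_inj tail_succ v; have [pred succK predK] := injF_bij succ_inj.
rewrite /indegree /outdegree -(card_imset _ succ_inj); congr #|pred_of_set _|.
apply/setP => e; rewrite inE; apply/imsetP/idP => [[f] | tail_e].
  by rewrite inE => head_f ->; rewrite tail_succ.
by exists (pred e); rewrite ?inE ?predK // -tail_succ predK.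
Qed.

(** The first edges of edge-disjoint paths are distinct. *)
Lemma outdegree_immersion (H G : digraph) (gV : vertex H -> vertex G)
    (gE : edge H -> seq (edge G)) (u : vertex H) :
  is_immersion gV gE -> outdegree u <= outdegree (gV u).
Proof.
case=> _ gE_path gE_disj.
have first_edge e : {f | f \in gE e & tail_of f = gV (tail_of e)}.
  have := gE_path e; case: (gE e) => // f s /and4P[_ _ /eqP tail_f _].
  by exists f; rewrite ?mem_head.
pose first e := s2val (first_edge e).
have first_in e : first e \in gE e by exact: s2valP (first_edge e).
have tail_first e : tail_of (first e) = gV (tail_of e).
  exact: s2valP' (first_edge e).
have first_inj : injective first.
  move=> e f eq_ef; apply/eqP/contraT => /gE_disj/(_ (first_in e)).
  by rewrite eq_ef first_in.
rewrite /outdegree -(card_imset _ first_inj); apply/subset_leq_card/subsetP.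
by move=> _ /imsetP[e + ->]; rewrite !inE tail_first => /eqP->.
Qed.

(* An element (b, i) of bool * 'I_n is the edge of the alternating cycle from
   source i to sink i (b = false) or to sink i + 1 mod n (b = true). *)
Definition cycle_sink n (x : bool * 'I_n) : 'I_n :=
  if x.1 then ordS x.2 else x.2.

Lemma cycle_sink_inj n (x y : bool * 'I_n) :
  x.1 = y.1 -> cycle_sink x = cycle_sink y -> x = y.
Proof.
case: x y => [b i] [c j] /= ->; rewrite /cycle_sink /=.
by case: c => [/ordS_inj|] ->.
Qed.

(* The hub is None, the sources are Some (false, i) and the sinks are
   Some (true, i).  The edges (Some false, x), (None, x), (Some true, x) form
   the triangle hub -> source -> sink -> hub through the cycle edge x. *)
Definition hub_cycle (n : nat) : digraph :=
  @Digraph (option (bool * 'I_n)) (option bool * (bool * 'I_n))%type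
    (fun e => match e.1 with
              | Some false => None
              | None => Some (false, e.2.2)
              | Some true => Some (true, cycle_sink e.2)
              end)
    (fun e => match e.1 with
              | Some false => Some (false, e.2.2)
              | None => Some (true, cycle_sink e.2)
              | Some true => None
              end).

Lemma hub_cycle_eulerian n : eulerian (hub_cycle n).
Proof.
pose succ (e : edge (hub_cycle n)) : edge (hub_cycle n) :=
  (match e.1 with
   | Some false => None
   | None => Some true
   | Some true => Some false
   end, e.2).
apply: (@eulerian_of_succ _ succ) => [[[[]|] x] [[[]|] y] | [[[]|] x]] //.
- by case=> ->.
- by case=> ->.
- by case=> ->.
Qed.

Lemma outdegree_hub n : n.*2 <= outdegree (None : vertex (hub_cycle n)).
Proof.
have out_inj : injective (fun x : bool * 'I_n => (Some false, x)).
  by move=> x y [].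
have <- : #|[set (Some false, x) | x : bool * 'I_n]| = n.*2.
  by rewrite card_imset // card_prod card_bool card_ord mul2n.
by apply/subset_leq_card/subsetP => _ /imsetP[x _ ->]; rewrite inE.
Qed.

Lemma outdegree_not_hub n (v : vertex (hub_cycle n)) :
  v != None -> outdegree v <= 2.
Proof.
case: v => // v _; rewrite /outdegree -card_bool.
(* The Boolean tells apart the edges leaving a given source or sink. *)
rewrite -(@card_in_imset _ _ (fun e : edge (hub_cycle n) => e.2.1)) ?max_card //.
move=> [k x] [l y]; rewrite !inE => /eqP + /eqP /=.
case: k => [[]|] //; case: l => [[]|] // [<-] [] //.
  by move=> /esym eq_sink eq1; rewrite (cycle_sink_inj eq1 eq_sink).
by case: x y => [b i] [c j] /= -> ->.
Qed.

Lemma hub_cycle_path_avoiding_hub n (u v : vertex (hub_cycle n)) p :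
    is_path u v p -> u != None -> v != None ->
    None \notin internal_vertices p ->
  exists x, [/\ p = [:: (None, x)], u = Some (false, x.2)
             & v = Some (true, cycle_sink x)].
Proof.
case: p => [|[k x] s] //= /and4P[_ + /eqP<- /eqP<-].
case: s => [|[l y] s] /=; first by case: k => [[]|] // *; exists x.
by case: k => [[]|] //= /andP[]; case: l => [[]|] // _; case: s.
Qed.

(* An embedding of alternating cycles maps the other edge at a source or sink to
   the other edge at its image, so the set of image edges is closed under moving
   along the target cycle. *)
Lemma cycle_embedding_eq m n (phi : bool * 'I_m -> bool * 'I_n) :
    0 < m -> injective phi ->
    (forall x y, x.2 = y.2 -> (phi x).2 = (phi y).2) ->
    (forall x y, cycle_sink x = cycle_sink y ->
       cycle_sink (phi x) = cycle_sink (phi y)) ->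
  n = m.
Proof.
move=> m_gt0 phi_inj phi_source phi_sink.
have same_source x : phi (~~ x.1, x.2) = (~~ (phi x).1, (phi x).2).
  have := phi_source (~~ x.1, x.2) x erefl.
  have : phi (~~ x.1, x.2) != phi x.
    by rewrite (inj_eq phi_inj); case: x => [[] i]; rewrite xpair_eqE.
  case: (phi _) (phi x) => [b i] [c j] /= + eq_ij; rewrite eq_ij xpair_eqE eqxx.
  by case: b c => [] [].
have same_sink x y : x.1 != y.1 -> cycle_sink x = cycle_sink y ->
    (phi x).1 != (phi y).1.
  move=> neq_xy /phi_sink eq_sink; apply: contra neq_xy => /eqP eq1.
  by rewrite (phi_inj _ _ (cycle_sink_inj eq1 eq_sink)).
have next x : exists y, phi y = (false, ordS (phi x).2).
  (* Otherwise pass to the other edge at the source of [x]. *)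
  wlog phi_x : x / (phi x).1 = true.
    case phi1: (phi x).1 => [] IH; first exact: IH.
    by have := IH (~~ x.1, x.2); rewrite same_source /= phi1; apply.
  (* The other cycle edge at the sink of [x]. *)
  pose y := (~~ x.1, if x.1 then ordS x.2 else ord_pred x.2).
  have eq_sink : cycle_sink y = cycle_sink x.
    by rewrite /y /cycle_sink /=; case: x.1; rewrite //= ord_predK.
  have /same_sink/(_ eq_sink) : y.1 != x.1 by rewrite /=; case: x.1.
  have := phi_sink _ _ eq_sink; rewrite phi_x /cycle_sink phi_x.
  by move=> sink_eq neq1; exists y; case: (phi y) sink_eq neq1 => [[] i] //= ->.
have hit_source j : exists x, (phi x).2 = j.
  pose x0 := (false, Ordinal m_gt0).
  have iter_hit k : exists x, (phi x).2 = iter k (@ordS n) (phi x0).2.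
    elim: k => [|k [x phi_x]]; first by exists x0.
    by have [y phi_y] := next x; exists y; rewrite phi_y phi_x.
  have iterE k (i : 'I_n) : iter k (@ordS n) i = (i + k) %% n :> nat.
    elim: k => [|k IH]; first by rewrite addn0 modn_small.
    by rewrite iterS /= IH -addn1 modnDml addn1 addnS.
  (* Modulo [n], this many steps lead from [(phi x0).2] to [j]. *)
  have [x phi_x] := iter_hit (j + (n - (phi x0).2)).
  exists x; apply: val_inj; rewrite phi_x [LHS]iterE addnCA subnKC 1?ltnW //.
  by rewrite modnDr modn_small.
have phi_onto z : z \in codom phi.
  have [x phi_x] := hit_source z.2; case eq_z: ((phi x).1 == z.1).
    apply/codomP; exists x; rewrite [LHS]surjective_pairing.
    by rewrite [RHS]surjective_pairing phi_x (eqP eq_z).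
  apply/codomP; exists (~~ x.1, x.2); rewrite same_source phi_x.
  by case: z (phi x).1 eq_z {phi_x} => [[] i] [].
have := card_codom phi_inj; rewrite (eq_card (B := predT) phi_onto).
by rewrite !card_prod card_bool !card_ord => /eqP; rewrite eqn_pmul2l // => /eqP.
Qed.

Lemma hub_cycle_immersion_eq m n :
  1 < m -> strongly_immerses (hub_cycle m) (hub_cycle n) -> n = m.
Proof.
move=> m_gt1 [gV [gE [imm strong]]].
have gV_hub : gV None = None.
  (* Otherwise the out-degree of [gV None] would be at least [m.*2] and at most 2, against
     [1 < m]. *)
  apply/eqP/contraT => /outdegree_not_hub.
  have := leq_trans (outdegree_hub m) (outdegree_immersion _ imm).
  move=> /leq_trans/[apply]; rewrite (leq_double _ 1) => /(leq_trans m_gt1).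
  by rewrite ltnn.
case: imm => gV_inj gE_path gE_disj.
have gV_not_hub v : v != None -> gV v != None.
  by rewrite -gV_hub (inj_eq gV_inj).
have image_edge x : exists y,
    [/\ gE (None, x) = [:: (None, y)], gV (Some (false, x.2)) = Some (false, y.2)
      & gV (Some (true, cycle_sink x)) = Some (true, cycle_sink y)].
  apply: hub_cycle_path_avoiding_hub (gE_path (None, x)) _ _ _ => /=.
  - exact: gV_not_hub.
  - exact: gV_not_hub.
  - by rewrite -[X in X \notin _]gV_hub strong.
have [phi phiP] := fin_all_exists image_edge.
apply: (@cycle_embedding_eq m n phi); first exact: ltnW.
- move=> x y eq_phi; apply/eqP/contraT => neq_xy.
  have [gEx _ _] := phiP x; have [gEy _ _] := phiP y.
  have := gE_disj (None, x) (None, y) (None, phi x).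
  by rewrite gEx gEy eq_phi xpair_eqE mem_head => /(_ neq_xy isT).
- move=> x y eq_xy; have [_ + _] := phiP x; have [_ + _] := phiP y.
  by rewrite eq_xy => -> [].
- move=> x y eq_xy; have [_ _] := phiP x; have [_ _] := phiP y.
  by rewrite eq_xy => -> [].
Qed.

Theorem theorem1p1 :
  ~ well_quasi_ordered eulerian strongly_immerses /\
  exists G : nat -> digraph,
    (forall i : nat, eulerian (G i)) /\
    (forall i j : nat, i < j -> ~ strongly_immerses (G i) (G j)).
Proof.
(* The shift by two gives every hub out-degree at least 4. *)
have bad i j : i < j ->
    ~ strongly_immerses (hub_cycle i.+2) (hub_cycle j.+2).
  move=> lt_ij /hub_cycle_immersion_eq-/(_ isT) [] eq_ij.
  by rewrite eq_ij ltnn in lt_ij.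
have eul i : eulerian (hub_cycle i.+2) by exact: hub_cycle_eulerian.
split; last by exists (fun i => hub_cycle i.+2).
by move=> wqo; have [i [j [/bad]]] := wqo _ eul.
Qed.
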